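(* Let $M\ge2$. Observe $\mathbf y=\mathbf f+\boldsymbol\xi$ with $\boldsymbol\xi\sim\mathcal N(0,\sigma^2I_{n\times n})$. For $j=1,\dots,M$ let $\hat{\boldsymbol\mu}_j=A_j\mathbf y+\mathbf b_j$ with deterministic $n\times n$ matrices satisfying $\|A_j\|_{op}\le1$ and deterministic $\mathbf b_j\in\mathbf R^n$. Let $\boldsymbol\pi=(\pi_1,\dots,\pi_M)^T\in\Lambda^M$ (deterministic). Let $\hat{\boldsymbol\theta}_{\boldsymbol\pi}\in\arg\min_{\boldsymbol\theta\in\Lambda^M}V_{\mathrm{pen}}(\boldsymbol\theta)$, where $V_{\mathrm{pen}}(\boldsymbol\theta)=H_{\mathrm{pen}}(\boldsymbol\theta)+46\sigma^2\sum_{j=1}^M\theta_j\log\frac1{\pi_j}$. Then for all $x>0$, with probability at least $1-2e^{-x}$, \[\|\hat{\boldsymbol\mu}_{\hat{\boldsymbol\theta}_{\boldsymbol\pi}}-\mathbf f\|_2^2\le\min_{j=1,\dots,M}\Big(\|\hat{\boldsymbol\mu}_j-\mathbf f\|_2^2+92\sigma^2\log\frac1{\pi_j}\Big)+46\sigma^2x.\]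
   Context: $\Lambda^M=\{\boldsymbol\theta\in\mathbf R^M:\sum_j\theta_j=1,\theta_j\ge0\}$. For $\boldsymbol\theta\in\Lambda^M$: $A_{\boldsymbol\theta}=\sum_j\theta_jA_j$, $\mathbf b_{\boldsymbol\theta}=\sum_j\theta_j\mathbf b_j$, $\hat{\boldsymbol\mu}_{\boldsymbol\theta}=A_{\boldsymbol\theta}\mathbf y+\mathbf b_{\boldsymbol\theta}$. $C_p(\boldsymbol\theta)=\|\hat{\boldsymbol\mu}_{\boldsymbol\theta}\|_2^2-2\mathbf y^T\hat{\boldsymbol\mu}_{\boldsymbol\theta}+2\sigma^2\mathrm{Tr}(A_{\boldsymbol\theta})$, $\mathrm{pen}(\boldsymbol\theta)=\sum_j\theta_j\|\hat{\boldsymbol\mu}_{\boldsymbol\theta}-\hat{\boldsymbol\mu}_j\|_2^2$, $H_{\mathrm{pen}}=C_p+\tfrac12\mathrm{pen}$. Natural logarithm; $\log(1/0)=+\infty$. *)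

(* Defs.v *)
From HB Require Import structures.
From mathcomp Require Import all_boot all_order all_algebra.
From mathcomp Require Import all_classical all_reals all_analysis.
Set Implicit Arguments. Unset Strict Implicit. Unset Printing Implicit Defensive.
Import Order.TTheory GRing.Theory Num.Theory.
Local Open Scope ring_scope.

Section defs.
Variables (R : realType) (n M : nat).

Definition sqn (v : 'cV[R]_n) : R := \sum_(i < n) (v i 0) ^+ 2.

Definition dotv (u v : 'cV[R]_n) : R := \sum_(i < n) u i 0 * v i 0.

Definition opnorm_le1 (A : 'M[R]_n) : Prop := forall v : 'cV[R]_n, sqn (A *m v) <= sqn v.

Definition in_simplex (th : 'I_M -> R) : Prop :=
  (forall j, 0 <= th j) /\ \sum_(j < M) th j = 1.

Variables (A : 'I_M -> 'M[R]_n) (b : 'I_M -> 'cV[R]_n) (sigma : R).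

Definition Ath (th : 'I_M -> R) : 'M[R]_n := \sum_(j < M) th j *: A j.
Definition bth (th : 'I_M -> R) : 'cV[R]_n := \sum_(j < M) th j *: b j.
Definition muj (j : 'I_M) (y : 'cV[R]_n) : 'cV[R]_n := A j *m y + b j.
Definition muth (th : 'I_M -> R) (y : 'cV[R]_n) : 'cV[R]_n := Ath th *m y + bth th.

Definition Cp (th : 'I_M -> R) (y : 'cV[R]_n) : R :=
  sqn (muth th y) - 2 * dotv y (muth th y) + 2 * sigma ^+ 2 * \tr (Ath th).

Definition pen (th : 'I_M -> R) (y : 'cV[R]_n) : R :=
  \sum_(j < M) th j * sqn (muth th y - muj j y).

Definition Hpen (th : 'I_M -> R) (y : 'cV[R]_n) : R := Cp th y + pen th y / 2.

Definition logInv (p : R) : \bar R := if p == 0 then +oo%E else (ln p^-1)%:E.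

(* V_pen(theta) = H_pen(theta) + 46 sigma^2 sum_j theta_j log(1/pi_j)
   (extended-real valued; 0 * (+oo) = 0) *)
Definition Vpen (pi : 'I_M -> R) (th : 'I_M -> R) (y : 'cV[R]_n) : \bar R :=
  ((Hpen th y)%:E + (46 * sigma ^+ 2)%:E * \sum_(j < M) (th j)%:E * logInv (pi j))%E.

End defs.

(* Main.v *)
Require Import Defs.
From HB Require Import structures.
From mathcomp Require Import all_boot all_order all_algebra.
From mathcomp Require Import ring lra.
From mathcomp Require Import all_classical all_reals all_analysis measurable_realfun.
Import Order.TTheory GRing.Theory Num.Theory.
Local Open Scope ring_scope.
Local Open Scope classical_set_scope.

(** Write [m j] for the j-th estimator and [xi] for the noise. The objective is
    half the squared norm of the mixture plus a linear function of [theta], so its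
    minimiser over the simplex satisfies [V theta + |m k - m_theta|^2 / 2 <= V e_k]
    at each vertex. Rearranged, this bounds [|m_theta - f|^2 - |m k - f|^2] by a
    [theta]-average over [j] of
    [2 xi.(m j - m k) - 2 sigma^2 tr (A j - A k) - |m j - m k|^2 / 2] and the prior
    terms.

    Divided by [46 sigma^2], this quadratic function of the Gaussian noise has
    exponential moment at most [1]: the negative square absorbs both the second
    order term of the chaos and the linear term. The moment is bounded by integrating
    out one coordinate at a time, which replaces the quadratic form by its Schur
    complement. Averaging the exponentials with weights [pi j * pi k] and applying
    Markov's inequality once controls all pairs simultaneously, with probability
    [1 - exp (- x)]. *)

(** * One-dimensional Gaussian integrals *)

Lemma ge0_integral_normal_prob (R : realType) (m s : R) (h : R -> \bar R) :
  measurable_fun [set: R] h -> (forall x, 0 <= h x)%E ->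
  (\int[normal_prob m s]_x h x =
   \int[lebesgue_measure]_x (h x * (normal_pdf m s x)%:E))%E.
Proof.
move=> mh h0.
have dom := normal_prob_dominates m s.
rewrite -(Radon_Nikodym_SigmaFinite.change_of_variables dom)//.
have intRN := Radon_Nikodym_SigmaFinite.f_integrable dom.
apply: ae_eq_integral => //.
- by apply: emeasurable_funM => //; exact: measurable_int intRN.
- apply: emeasurable_funM => //; apply/measurable_EFinP.
  exact: measurable_normal_pdf.
(* Both densities integrate to [normal_prob] over every measurable set, hence agree almost
   everywhere. *)
- apply: ae_eqe_mul2l; apply: integral_ae_eq => //.
  + by apply/measurable_EFinP; exact: measurable_normal_pdf.
  + by move=> E _ mE; rewrite -Radon_Nikodym_SigmaFinite.f_integral.
Qed.

(** Completing the square: the integrand times the centred density is a constant multiple of the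
    normal density with mean [sigma * c / k] and standard deviation [sigma / Num.sqrt k]. *)
Lemma integral_normal_prob_exp_quadratic (R : realType) (sigma k c : R) :
  0 < sigma -> 0 < k ->
  (\int[normal_prob 0 sigma]_s
     (expR ((1 - k) * (s / sigma) ^+ 2 / 2 + c * (s / sigma)))%:E
   = ((Num.sqrt k)^-1 * expR (c ^+ 2 / k / 2))%:E)%E.
Proof.
move=> s0 k0; have sn0 := lt0r_neq0 s0; have kn0 := lt0r_neq0 k0.
have qk0 : 0 < Num.sqrt k by rewrite sqrtr_gt0.
have qkn0 := lt0r_neq0 qk0.
rewrite ge0_integral_normal_prob; last 2 first.
- apply/measurable_EFinP; apply: measurableT_comp => //.
  apply: measurable_funD; last by apply: measurable_funM => //; exact: measurable_funM.
  do 2 apply: measurable_funM => //.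
  by apply: measurable_funX; exact: measurable_funM.
- by move=> x; rewrite lee_fin expR_ge0.
transitivity (\int[lebesgue_measure]_x
    (((Num.sqrt k)^-1 * expR (c ^+ 2 / k / 2))%:E *
     (normal_pdf (sigma * c / k) (sigma / Num.sqrt k) x)%:E))%E.
  apply: eq_integral => x _; rewrite -!EFinM; congr EFin.
  have s'0 : sigma / Num.sqrt k != 0 by rewrite mulf_neq0// invr_neq0.
  rewrite !normal_pdfE//= /normal_peak /normal_fun.
  have -> : (sigma / Num.sqrt k) ^+ 2 = sigma ^+ 2 / k.
    by rewrite exprMn exprVn sqr_sqrtr// ltW.
  have -> : Num.sqrt (sigma ^+ 2 / k * trigo.pi *+ 2) =
      Num.sqrt (sigma ^+ 2 * trigo.pi *+ 2) / Num.sqrt k.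
    rewrite -sqrtrV ?(ltW k0)// -sqrtrM; last first.
      by rewrite mulrn_wge0// mulr_ge0 ?sqr_ge0 ?pi_ge0.
    by congr Num.sqrt; rewrite -!mulrnAl mulrAC.
  rewrite invf_div.
  rewrite [LHS]mulrCA -expRD.
  set w := (Num.sqrt (sigma ^+ 2 * trigo.pi *+ 2))^-1.
  rewrite -!mulrA [in RHS](mulrCA (expR _)) (mulKf qkn0) [in RHS](mulrCA (expR _)).
  rewrite -expRD; congr (_ * expR _).
  by field; rewrite sn0 kn0.
rewrite ge0_integralZl//=; last 2 first.
- by apply/measurable_EFinP; exact: measurable_normal_pdf.
- by move=> x _; rewrite lee_fin normal_pdf_ge0.
- by rewrite integral_normal_pdf mule1.
Qed.

(** * Integration over an independent variable *)

Section integrate_out_independent.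
Context (d : measure_display) (T : measurableType d) (R : realType).
Variables (P : probability T R) (X : T -> R) (mu : probability (measurableTypeR R) R).
Variable G : set (set T).
Hypotheses (mX : measurable_fun setT X) (mG : G `<=` measurable).
Hypotheses (GT : G setT) (GI : setI_closed G).
Hypothesis indep : forall (B : set R) C, measurable B -> G C ->
  P (X @^-1` B `&` C) = (mu B * P C)%E.

Let sG := g_sigma_algebraType G.

Let sG_measurable (C : set T) : <<s G >> C -> measurable C.
Proof. by move=> sC; apply: smallest_sub sC => //; exact: sigma_algebra_measurable. Qed.

(** As functions of [C], both sides are finite measures that agree on the pi-system [G], hence on
    the sigma-algebra it generates. *)
Lemma indep_g_sigma_algebra (B : set R) C : measurable B -> <<s G >> C ->
  P (X @^-1` B `&` C) = (mu B * P C)%E.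
Proof.
move=> mB sC.
have mXB : measurable (X @^-1` B) by rewrite -[X in measurable X]setTI; exact: mX.
have muB0 : 0 <= fine (mu B) by rewrite fine_ge0.
rewrite setIC -(fineK (fin_num_measure mu _ mB)).
apply: (g_sigma_algebra_measure_unique G mG (fun _ : nat => setT) (fun=> GT) _
  (mrestr P mXB) (mscale (NngNum muB0) P) GI) => //.
- by rewrite bigcup_const.
- move=> A GA; transitivity (P (X @^-1` B `&` A)); first by rewrite setIC.
  by rewrite indep// -[in LHS](fineK (fin_num_measure mu _ mB)).
- move=> _; apply: (@le_lt_trans _ _ 1%E); last exact: ltry.
  by apply: (@probability_le1 _ _ _ P (setT `&` X @^-1` B)); exact: measurableI.
Qed.

(** Measurability over [sG] lets the second argument of [h] see only events independent of [X]. On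
    this smaller product sigma-algebra the law of [(X w, w)] is a product measure, and Tonelli
    applies. *)
Lemma integral_integrate_out (h : measurableTypeR R * sG -> \bar R) :
  measurable_fun setT h -> (forall z, 0 <= h z)%E ->
  (\int[P]_w h (X w, w) = \int[P]_w \int[mu]_s h (s, w))%E.
Proof.
move=> mh h0.
have midG : measurable_fun setT (idfun : T -> sG).
  by move=> _ C mC; rewrite setTI; exact: sG_measurable.
have mpG : measurable_fun setT (fun w => (X w, w) : measurableTypeR R * sG).
  by apply/measurable_fun_pair.
pose idG : {mfun T >-> sG} := HB.pack (idfun : T -> sG)
  (isMeasurableFun.Build _ _ _ _ _ midG).
pose pG : {mfun T >-> (measurableTypeR R * sG)%type} :=
  HB.pack (fun w => (X w, w) : measurableTypeR R * sG)
  (isMeasurableFun.Build _ _ _ _ _ mpG).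
have -> : (\int[P]_w h (X w, w) = \int[distribution P pG]_z h z)%E.
  by rewrite ge0_integral_distribution.
rewrite (@eq_measure_integral _ _ _ _ (mu \x distribution P idG)%E); last first.
  move=> A mA _; apply/esym; apply: product_measure_unique => // B C mB mC.
  exact: indep_g_sigma_algebra.
rewrite fubini_tonelli2// ge0_integral_distribution//.
- exact: measurable_fun_fubini_tonelli_G.
- by move=> w; apply: integral_ge0.
Qed.

End integrate_out_independent.

(** * Quadratic forms and Schur complements *)

Section quadratic_form.
Context {R : realType}.

Definition qform {n} (K : 'I_n -> 'I_n -> R) (z : 'I_n -> R) : R :=
  \sum_(i < n) \sum_(j < n) K i j * (z i * z j).

Definition consv {n} (s : R) (z : 'I_n -> R) (i : 'I_n.+1) : R :=
  if unlift ord0 i is Some j then z j else s.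

Lemma consv0 n s (z : 'I_n -> R) : consv s z ord0 = s.
Proof. by rewrite /consv unlift_none. Qed.

Lemma consvS n s (z : 'I_n -> R) i : consv s z (lift ord0 i) = z i.
Proof. by rewrite /consv liftK. Qed.

Lemma qform_recl n (K : 'I_n.+1 -> 'I_n.+1 -> R) (z : 'I_n.+1 -> R) :
  (forall i j, K i j = K j i) ->
  qform K z = K ord0 ord0 * z ord0 ^+ 2
    + 2 * z ord0 * (\sum_(j < n) K ord0 (lift ord0 j) * z (lift ord0 j))
    + qform (fun i j => K (lift ord0 i) (lift ord0 j)) (fun i => z (lift ord0 i)).
Proof.
move=> Ksym; rewrite /qform; under [LHS]eq_bigr do rewrite big_ord_recl.
rewrite big_ord_recl/= big_split/= !addrA; congr (_ + _); rewrite -!addrA.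
congr (_ + _).
rewrite -big_split/= big_distrr/=; apply: eq_bigr => j _.
by rewrite (Ksym (lift ord0 j)); ring.
Qed.

(** When [k] is the pivot of a larger symmetric matrix, [c] the rest of its row and [K] the
    remaining block, the kernel on the left is the Schur complement. *)
Lemma qform_schur n (K : 'I_n -> 'I_n -> R) (c z : 'I_n -> R) (k : R) :
  qform (fun i j => K i j - c i * c j / k) z =
  qform K z - (\sum_(i < n) c i * z i) ^+ 2 / k.
Proof.
rewrite /qform expr2 big_distrl/= big_distrl/= -sumrB; apply: eq_bigr => i _.
rewrite big_distrr/= big_distrl/= -sumrB; apply: eq_bigr => j _; ring.
Qed.

End quadratic_form.

(** The square root of [1 + u <= expR u] at [u = k^-1 - 1]. It trades the determinant factor of a
    Gaussian integral for a trace of the inverse. *)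
Lemma invsqrt_le_expR (R : realType) (k : R) : 0 < k ->
  (Num.sqrt k)^-1 <= expR ((k^-1 - 1) / 2).
Proof.
move=> k0; rewrite -sqrtrV ?(ltW k0)//.
rewrite -[leRHS]ger0_norm ?expR_ge0// -sqrtr_sqr ler_wsqrtr//.
rewrite -expRM_natl mulr_natl -mulr_natr divfK//.
by have := expR_ge1Dx (k^-1 - 1); rewrite addrC subrK.
Qed.

(** * Independent normal families *)

Definition iid_normal {d : measure_display} {T : measurableType d} {R : realType}
    (P : probability T R) (sigma : R) (n : nat) (xi : 'I_n -> T -> R) : Prop :=
  [/\ forall i, measurable_fun setT (xi i),
      forall i (B : set R), measurable B -> P (xi i @^-1` B) = normal_prob 0 sigma B &
      forall B : 'I_n -> set R, (forall i, measurable (B i)) ->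
        fine (P (\bigcap_(i in [set: 'I_n]) (xi i @^-1` B i)))
        = \prod_(i < n) fine (P (xi i @^-1` B i))].

(** A pi-system generating the sigma-algebra of the family [xi]; it serves as [G] when a further
    coordinate is integrated out. *)
Definition boxes {T : Type} {R : realType} (n : nat) (xi : 'I_n -> T -> R) :
    set (set T) :=
  [set C | exists B : 'I_n -> set R,
    (forall i, measurable (B i)) /\ C = \bigcap_(i in [set: 'I_n]) (xi i @^-1` B i)].

Section iid_normal_theory.
Context {d : measure_display} {T : measurableType d} {R : realType}.
Variables (P : probability T R) (sigma : R).

Lemma bigcap_preimage_recl n (xi : 'I_n.+1 -> T -> R) (B0 : set R) (B : 'I_n -> set R) :
  \bigcap_(i in [set: 'I_n.+1])
    (xi i @^-1` (if unlift ord0 i is Some j then B j else B0)) =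
  xi ord0 @^-1` B0 `&` \bigcap_(i in [set: 'I_n]) (xi (lift ord0 i) @^-1` B i).
Proof.
apply/seteqP; split => w.
  move=> Bw; split; first by have := Bw ord0 Logic.I; rewrite /= unlift_none.
  by move=> j _; have := Bw (lift ord0 j) Logic.I; rewrite /= liftK.
move=> [B0w Bw] i _ /=; case: unliftP => [j ->|->]; last exact: B0w.
exact: Bw.
Qed.

Lemma iid_normal_indep n (xi : 'I_n.+1 -> T -> R) (B0 : set R) (B : 'I_n -> set R) :
  iid_normal P sigma n.+1 xi -> measurable B0 -> (forall i, measurable (B i)) ->
  fine (P (xi ord0 @^-1` B0 `&`
           \bigcap_(i in [set: 'I_n]) (xi (lift ord0 i) @^-1` B i)))
  = fine (P (xi ord0 @^-1` B0)) * \prod_(i < n) fine (P (xi (lift ord0 i) @^-1` B i)).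
Proof.
move=> [_ _ indep] mB0 mB; rewrite -bigcap_preimage_recl indep; last first.
  by move=> i; case: unlift.
rewrite big_ord_recl/= unlift_none; congr (_ * _).
by apply: eq_bigr => i _; rewrite liftK.
Qed.

Lemma iid_normal_behead n (xi : 'I_n.+1 -> T -> R) :
  iid_normal P sigma n.+1 xi ->
  iid_normal P sigma n (fun i => xi (lift ord0 i)).
Proof.
move=> iid; have [mxi lxi _] := iid.
split=> [i|i|B mB]; [exact: mxi|exact: lxi|].
have := iid_normal_indep n xi setT B iid measurableT mB.
by rewrite preimage_setT setTI probability_setT/= mul1r.
Qed.

Lemma boxes_measurable n (xi : 'I_n -> T -> R) :
  (forall i, measurable_fun setT (xi i)) -> boxes n xi `<=` measurable.
Proof.
move=> mxi _ [B [mB ->]]; apply: fin_bigcap_measurable => // i _.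
by rewrite -[X in measurable X]setTI; exact: mxi.
Qed.

Lemma boxesT n (xi : 'I_n -> T -> R) : boxes n xi setT.
Proof.
exists (fun=> setT); split=> //; apply/esym; rewrite -subTset => w _ i _.
exact: Logic.I.
Qed.

Lemma boxesI n (xi : 'I_n -> T -> R) : setI_closed (boxes n xi).
Proof.
move=> _ _ [B [mB ->]] [C [mC ->]]; exists (fun i => B i `&` C i); split.
  by move=> i; exact: measurableI.
by rewrite -bigcapI.
Qed.

Lemma boxes_coord n (xi : 'I_n -> T -> R) i :
  measurable_fun setT (xi i : g_sigma_algebraType (boxes n xi) -> R).
Proof.
move=> _ B mB; rewrite setTI; apply: sub_sigma_algebra.
exists (fun j => if j == i then B else setT); split; first by move=> j; case: ifP.
apply/seteqP; split => w; last by move=> /(_ i Logic.I) /=; rewrite eqxx.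
by move=> Bw j _ /=; case: eqP => // ->.
Qed.

Lemma iid_normal_boxes n (xi : 'I_n.+1 -> T -> R) (B : set R) (C : set T) :
  iid_normal P sigma n.+1 xi -> measurable B ->
  boxes n (fun i => xi (lift ord0 i)) C ->
  P (xi ord0 @^-1` B `&` C) = (normal_prob 0 sigma B * P C)%E.
Proof.
move=> iid mB [D [mD ->]]; have [mxi lxi _] := iid.
have mbox : measurable (\bigcap_(i in [set: 'I_n]) (xi (lift ord0 i) @^-1` D i)).
  by apply: (boxes_measurable n (fun i => xi (lift ord0 i))) => //; exists D.
have mxB : measurable (xi ord0 @^-1` B).
  by rewrite -[X in measurable X]setTI; exact: mxi.
rewrite -(lxi ord0)// -(fineK (fin_num_measure P _ (measurableI _ _ mxB mbox))).
rewrite iid_normal_indep//.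
have [_ _ indep] := iid_normal_behead n xi iid.
by rewrite -(indep _ mD) EFinM !fineK// fin_num_measure.
Qed.

End iid_normal_theory.

(** * Exponential moments of Gaussian quadratic forms *)

Section gaussian_exp_moment.
Context {d : measure_display} {T : measurableType d} {R : realType}.
Variables (P : probability T R) (sigma : R).
Hypothesis sigma_gt0 : 0 < sigma.

(** For [k <= 0] the left side is unbounded as [t] grows; for [k > 0] its maximum, at [t = k^-1], is
    [k^-1]. *)
Let quadratic_pivot (k h : R) :
  (forall t, 2 * t - k * t ^+ 2 <= h) -> 0 < k /\ k^-1 <= h.
Proof.
move=> kh; have k0 : 0 < k.
  rewrite ltNge; apply/negP => k0.
  have := kh (`|h| + 1); have := ler_norm h; have := normr_ge0 h.
  by set u := `|h|; nra.
split=> //; have := kh k^-1.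
have -> : 2 * k^-1 - k * k^-1 ^+ 2 = k^-1 by field; rewrite lt0r_neq0.
by [].
Qed.

(* The certificates [h i] and [h0] are upper bounds on the diagonal entries of
   the inverse of [K] and on [a^T K^-1 a], stated as suprema of concave
   quadratics so that they survive elimination of a coordinate. *)
Lemma gaussian_exp_moment_le n (xi : 'I_n -> T -> R) (K : 'I_n -> 'I_n -> R)
    (a h : 'I_n -> R) (h0 : R) :
  iid_normal P sigma n xi -> (forall i j, K i j = K j i) ->
  (forall i z, 2 * z i - qform K z <= h i) ->
  (forall z, 2 * (\sum_(i < n) a i * z i) - qform K z <= h0) ->
  (\int[P]_w (expR ((\sum_(i < n) (xi i w / sigma) ^+ 2
      - qform K (fun i => xi i w / sigma)) / 2
      + \sum_(i < n) a i * (xi i w / sigma)))%:E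
   <= (expR ((\sum_(i < n) (h i - 1) + h0) / 2))%:E)%E.
Proof.
elim: n => [|n IH] in xi K a h h0 *.
  move=> _ _ _ /(_ (fun=> 0)); rewrite /qform !big_ord0 mulr0 subr0 => h0_ge0.
  under eq_integral do rewrite /qform !big_ord0 subr0 mul0r addr0.
  rewrite integral_cst//= probability_setT mule1 lee_fin ler_expR add0r.
  by rewrite divr_ge0.
move=> iid Ksym hi ha.
have [mxi lxi _] := iid.
pose k := K ord0 ord0.
pose c (j : 'I_n) := K ord0 (lift ord0 j).
pose K' i j := K (lift ord0 i) (lift ord0 j).
have qE s z : qform K (consv s z) =
    k * s ^+ 2 + 2 * s * (\sum_j c j * z j) + qform K' z.
  rewrite qform_recl// consv0; congr (_ + 2 * s * _ + _).
    by apply: eq_bigr => j _; rewrite consvS.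
  by congr qform; apply: funext => i; rewrite consvS.
have [k0 kh] : 0 < k /\ k^-1 <= h ord0.
  apply: quadratic_pivot => t; have := hi ord0 (consv t (fun=> 0)).
  rewrite qE consv0 big1 ?mulr0 ?addr0; last by move=> ? _; rewrite mulr0.
  rewrite (_ : qform K' _ = 0) ?addr0//.
  by rewrite /qform big1// => i _; rewrite big1// => j _; rewrite !mulr0.
have kn0 := lt0r_neq0 k0.
pose xi' i := xi (lift ord0 i).
(* [K2] and [a2] are the quadratic and linear parts that remain once coordinate [ord0] is integrated
   out. *)
pose K2 i j := K' i j - c i * c j / k.
pose a0 := a ord0.
pose a2 i := a (lift ord0 i) - a0 / k * c i.
have K2E z : qform K2 z = qform K' z - (\sum_i c i * z i) ^+ 2 / k.
  exact: qform_schur.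
have a2E z : \sum_i a2 i * z i =
    \sum_i a (lift ord0 i) * z i - a0 / k * \sum_i c i * z i.
  by rewrite big_distrr/= -sumrB; apply: eq_bigr => i _; rewrite mulrBl mulrA.
have aE s z : \sum_(i < n.+1) a i * consv s z i =
    a0 * s + \sum_(i < n) a (lift ord0 i) * z i.
  rewrite big_ord_recl consv0; congr (_ + _).
  by apply: eq_bigr => i _; rewrite consvS.
have {}IH : (\int[P]_w (expR ((\sum_(i < n) (xi' i w / sigma) ^+ 2
      - qform K2 (fun i => xi' i w / sigma)) / 2
      + \sum_(i < n) a2 i * (xi' i w / sigma)))%:E
    <= (expR ((\sum_(i < n) (h (lift ord0 i) - 1) + (h0 - a0 ^+ 2 / k)) / 2))%:E)%E.
  apply: IH => [|i j|i z|z].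
  - exact: iid_normal_behead.
  - by rewrite /K2 /K' Ksym (mulrC (c i)).
  (* The chosen first coordinate minimises the form of [K] at fixed [z], and the minimum is the form
     of [K2]. *)
  - have := hi (lift ord0 i) (consv (- (\sum_i c i * z i) / k) z).
    rewrite qE consvS K2E; set S := \sum_i c i * z i; congr (_ <= _).
    by field.
  (* This first coordinate maximises the left side of [ha] at fixed [z]; the maximum exceeds the
     reduced expression by [a0 ^+ 2 / k], which is taken out of [h0]. *)
  - have := ha (consv ((a0 - \sum_i c i * z i) / k) z).
    rewrite qE aE K2E a2E.
    rewrite lerBrDr; set S := \sum_i c i * z i; congr (_ <= _).
    by field.
(* The integrand is split into a factor of the tail alone and a Gaussian integrand in the first
   coordinate, whose linear coefficient depends on the tail. *)
pose H (p : measurableTypeR R * g_sigma_algebraType (boxes n xi')) : \bar R :=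
  (expR ((\sum_(i < n) (xi' i p.2 / sigma) ^+ 2
      - qform K' (fun i => xi' i p.2 / sigma)) / 2
      + \sum_(i < n) a (lift ord0 i) * (xi' i p.2 / sigma)) *
   expR ((1 - k) * (p.1 / sigma) ^+ 2 / 2
      + (a0 - \sum_(i < n) c i * (xi' i p.2 / sigma)) * (p.1 / sigma)))%:E.
have H_ge0 p : (0 <= H p)%E by rewrite lee_fin mulr_ge0 ?expR_ge0.
have mH : measurable_fun setT H.
  have mz i : measurable_fun setT
      (fun p : measurableTypeR R * g_sigma_algebraType (boxes n xi') =>
         xi' i p.2 / sigma).
    apply: measurable_funM => //.
    exact: measurableT_comp (boxes_coord n xi' i) measurable_snd.
  have ms : measurable_fun setT
      (fun p : measurableTypeR R * g_sigma_algebraType (boxes n xi') => p.1 / sigma).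
    by apply: measurable_funM => //; exact: measurable_fst.
  apply/measurable_EFinP; apply: measurable_funM; apply: measurableT_comp => //;
    apply: measurable_funD.
  - apply: measurable_funM => //; apply: measurable_funB.
      by apply: measurable_sum => i; apply: measurable_funX.
    apply: measurable_sum => i; apply: measurable_sum => j.
    by apply: measurable_funM => //; apply: measurable_funM.
  - by apply: measurable_sum => i; apply: measurable_funM.
  - apply: measurable_funM => //; apply: measurable_funM => //.
    exact: measurable_funX.
  - apply: measurable_funM => //; apply: measurable_funB => //.
    by apply: measurable_sum => i; apply: measurable_funM.
have -> : (\int[P]_w (expR ((\sum_(i < n.+1) (xi i w / sigma) ^+ 2
      - qform K (fun i => xi i w / sigma)) / 2
      + \sum_(i < n.+1) a i * (xi i w / sigma)))%:E
    = \int[P]_w H (xi ord0 w, w))%E.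
  apply: eq_integral => w _; rewrite /H -expRD; congr (expR _)%:E.
  rewrite qform_recl// !big_ord_recl/= -/k -/a0.
  rewrite /xi' /c /K'; set q := qform _ _; set S := \sum_(j < n) K _ _ * _.
  set u := \sum_(_ < n) _; set v := \sum_(_ < n) _; set s := xi ord0 w / sigma.
  by field.
rewrite (integral_integrate_out _ _ _ P (xi ord0) (normal_prob 0 sigma)
  (boxes n xi')) //; last 4 first.
- by apply: boxes_measurable => i; exact: mxi.
- exact: boxesT.
- exact: boxesI.
- by move=> B C mB bC; rewrite (iid_normal_boxes _ sigma).
(* The inner integral contributes [(a0 - S) ^+ 2 / k / 2] to the exponent, [S] being the sum of the
   [c i * z i]: its constant term goes to [C], its cross term to [a2], its square to [K2]. *)
pose C := (Num.sqrt k)^-1 * expR (a0 ^+ 2 / k / 2).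
have C_ge0 : 0 <= C by rewrite mulr_ge0 ?expR_ge0 ?invr_ge0 ?sqrtr_ge0.
have -> : (\int[P]_w \int[normal_prob 0 sigma]_s H (s, w) =
    \int[P]_w (C%:E * (expR ((\sum_(i < n) (xi' i w / sigma) ^+ 2
      - qform K2 (fun i => xi' i w / sigma)) / 2
      + \sum_(i < n) a2 i * (xi' i w / sigma)))%:E))%E.
  apply: eq_integral => w _; rewrite /H/=.
  under eq_integral do rewrite EFinM.
  rewrite ge0_integralZl//=; last first.
  - apply/measurable_EFinP; apply: measurableT_comp => //; apply: measurable_funD.
      do 2 apply: measurable_funM => //.
      by apply: measurable_funX; exact: measurable_funM.
    by apply: measurable_funM => //; exact: measurable_funM.
  rewrite integral_normal_prob_exp_quadratic// -!EFinM; congr EFin.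
  rewrite /C [LHS]mulrCA -[RHS]mulrA -!expRD; congr (_ * expR _).
  rewrite K2E a2E; set S := \sum_(i < n) c i * _; set q := qform _ _.
  by set u := \sum_(_ < n) _; set v := \sum_(_ < n) _; field.
rewrite ge0_integralZl//=; last first.
  have mz i : measurable_fun setT (fun w => xi' i w / sigma).
    by apply: measurable_funM => //; exact: mxi.
  apply/measurable_EFinP; apply: measurableT_comp => //; apply: measurable_funD.
    apply: measurable_funM => //; apply: measurable_funB.
      by apply: measurable_sum => i; apply: measurable_funX.
    apply: measurable_sum => i; apply: measurable_sum => j.
    by apply: measurable_funM => //; apply: measurable_funM.
  by apply: measurable_sum => i; apply: measurable_funM.
apply: (le_trans (lee_wpmul2l _ IH)); first by rewrite lee_fin.
rewrite -EFinM lee_fin /C.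
have -> : expR ((\sum_(i < n.+1) (h i - 1) + h0) / 2) =
    expR ((h ord0 - 1) / 2) *
    (expR (a0 ^+ 2 / k / 2) *
     expR ((\sum_(i < n) (h (lift ord0 i) - 1) + (h0 - a0 ^+ 2 / k)) / 2)).
  by rewrite -!expRD; congr expR; rewrite big_ord_recl; set u := \sum_(_ < n) _; ring.
rewrite -[leLHS]mulrA ler_wpM2r ?mulr_ge0 ?expR_ge0//.
apply: (le_trans (invsqrt_le_expR _ _ k0)).
by rewrite ler_expR ler_pM2r ?invr_gt0// lerD2r.
Qed.

End gaussian_exp_moment.

(** * The Euclidean inner product *)

Section dot_product.
Context {R : realType} {n : nat}.
Implicit Types (u v w : 'cV[R]_n) (B : 'M[R]_n).

Lemma dotvC u v : dotv u v = dotv v u.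
Proof. by apply: eq_bigr => i _; rewrite mulrC. Qed.

Lemma dotvDl u v w : dotv (u + v) w = dotv u w + dotv v w.
Proof. by rewrite -big_split/=; apply: eq_bigr => i _; rewrite mxE mulrDl. Qed.

Lemma dotvDr u v w : dotv w (u + v) = dotv w u + dotv w v.
Proof. by rewrite !(dotvC w) dotvDl. Qed.

Lemma dotvZl (k : R) u v : dotv (k *: u) v = k * dotv u v.
Proof. by rewrite big_distrr/=; apply: eq_bigr => i _; rewrite mxE mulrA. Qed.

Lemma dotvZr (k : R) u v : dotv u (k *: v) = k * dotv u v.
Proof. by rewrite dotvC dotvZl dotvC. Qed.

Lemma dotvNl u v : dotv (- u) v = - dotv u v.
Proof. by rewrite -scaleN1r dotvZl mulN1r. Qed.

Lemma dotvNr u v : dotv u (- v) = - dotv u v.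
Proof. by rewrite dotvC dotvNl dotvC. Qed.

Lemma sqnE v : sqn v = dotv v v.
Proof. by apply: eq_bigr => i _; rewrite expr2. Qed.

Lemma sqn_ge0 v : 0 <= sqn v.
Proof. by apply: sumr_ge0 => i _; exact: sqr_ge0. Qed.

Lemma dotv_trmx B u v : dotv u (B^T *m v) = dotv (B *m u) v.
Proof.
rewrite /dotv; under eq_bigr do rewrite mxE big_distrr/=.
rewrite exchange_big; apply: eq_bigr => i _; rewrite mxE big_distrl/=.
by apply: eq_bigr => j _; rewrite mxE; ring.
Qed.

Lemma dotv_delta (i : 'I_n) v : dotv (delta_mx i 0) v = v i 0.
Proof.
rewrite /dotv (bigD1 i)//= mxE !eqxx mul1r big1 ?addr0// => j /negPf ji.
by rewrite mxE ji mul0r.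
Qed.

Lemma mulmx_delta B (i l : 'I_n) : (B *m delta_mx i (0 : 'I_1)) l 0 = B l i.
Proof. by rewrite -colE mxE. Qed.

Lemma qform_dotv B (z : 'I_n -> R) : qform (fun i j => B i j) z =
  dotv (\col_i z i) (B *m \col_i z i).
Proof.
apply: eq_bigr => i _; rewrite !mxE big_distrr/=; apply: eq_bigr => j _.
by rewrite mxE; ring.
Qed.

End dot_product.

(** * The penalized Gaussian chaos *)

Section chaos_exp_moment.
Context {d : measure_display} {T : measurableType d} {R : realType}.
Variables (P : probability T R) (sigma : R) (n : nat) (xi : 'I_n -> T -> R).
Hypotheses (sigma_gt0 : 0 < sigma) (iid : iid_normal P sigma n xi).

(* The quadratic form of [K] is [(1 - 4 / 46) |z|^2 + |2 z - B z|^2 / 46]. *)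
Lemma penalized_chaos_exp_moment_le1 (B : 'M[R]_n) (v : 'cV[R]_n) :
  (forall y : 'cV[R]_n, sqn (B *m y) <= 4 * sqn y) ->
  (\int[P]_w (expR ((2 * dotv (\col_i xi i w) (B *m (\col_i xi i w) + v)
      - 2 * sigma ^+ 2 * \tr B - sqn (B *m (\col_i xi i w) + v) / 2)
      / (46 * sigma ^+ 2)))%:E <= 1)%E.
Proof.
move=> B2.
have sn0 := lt0r_neq0 sigma_gt0.
have [mxi _ _] := iid.
pose t : R := 46^-1.
have [u vE] : exists u, v = sigma *: u.
  by exists (sigma^-1 *: v); rewrite scalerA divff// scale1r.
pose K : 'M[R]_n := 1%:M - t *: (2 *: B + 2 *: B^T - B^T *m B).
pose a := t *: (2 *: u - B^T *m u).
(* The first line is the first-order expansion of the diagonal of the inverse of [K]. The second is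
   the price of Young's inequality for the cross terms, with [42 = 46 - 4]. *)
pose h i := 1 + t * (4 * B i i - \sum_l B l i ^+ 2)
  + t * (8 * \sum_l B i l ^+ 2 + 32 * \sum_l B l i ^+ 2) / 42.
have KE z : qform (fun i j => K i j) z = dotv (\col_i z i) (\col_i z i)
    - t * (4 * dotv (\col_i z i) (B *m \col_i z i)
           - dotv (B *m \col_i z i) (B *m \col_i z i)).
  rewrite qform_dotv; set Z := \col_i z i.
  rewrite /K mulmxBl mul1mx -scalemxAl mulmxBl mulmxDl -!scalemxAl -mulmxA.
  rewrite !(dotvDr, dotvNr, dotvZr) !dotv_trmx (dotvC (B *m Z) Z); ring.
have aE z : \sum_(i < n) a i 0 * z i = t * (2 * dotv u (\col_i z i)
    - dotv u (B *m \col_i z i)).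
  have -> : \sum_(i < n) a i 0 * z i = dotv a (\col_i z i).
    by apply: eq_bigr => i _; rewrite [X in _ = _ * X]mxE.
  rewrite /a !(dotvDl, dotvNl, dotvZl); congr (_ * (_ - _)).
  by rewrite (dotvC (B^T *m u)) dotv_trmx (dotvC u).
(* That is [|2 y - B y|^2 <= 16 |y|^2], since [B] has operator norm at most 2. *)
have w2 (y : 'cV[R]_n) : 4 * dotv y y - 4 * dotv y (B *m y)
    + dotv (B *m y) (B *m y) <= 16 * dotv y y.
  have := B2 y; have := sqn_ge0 (2 *: y + B *m y).
  rewrite !sqnE !(dotvDl, dotvDr, dotvZl, dotvZr) (dotvC (B *m y) y); lra.
have hi i z : 2 * z i - qform (fun i j => K i j) z <= h i.
  rewrite KE; pose e : 'cV[R]_n := delta_mx i 0.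
  have [y zE] : exists y, \col_i z i = e + y.
    by exists (\col_i z i - e); rewrite addrC subrK.
  have -> : z i = dotv e (\col_i z i) by rewrite dotv_delta mxE.
  have ee : dotv e e = 1 by rewrite dotv_delta mxE !eqxx.
  have Bii : dotv e (B *m e) = B i i by rewrite dotv_delta mulmx_delta.
  have bb : dotv (B *m e) (B *m e) = \sum_l B l i ^+ 2.
    by rewrite -sqnE; apply: eq_bigr => l _; rewrite mulmx_delta.
  have rr : dotv (B^T *m e) (B^T *m e) = \sum_l B i l ^+ 2.
    by rewrite -sqnE; apply: eq_bigr => l _; rewrite mulmx_delta mxE.
  have ry : dotv (B^T *m e) y = dotv e (B *m y) by rewrite dotvC dotv_trmx dotvC.
  have := w2 y.
  (* With [z = e + y] and [w = 2 y - B y], the part quadratic in [y] is [- t (42 |y|^2 + |w|^2)].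
     The cross terms [4 (B^T e).y] and [2 (B e).w] are each split by Young at a cost of [21 |y|^2],
     the second through [w2]. *)
  have := sqn_ge0 (B^T *m e - (21 / 2) *: y).
  have := sqn_ge0 (B *m e - (21 / 16) *: (2 *: y - B *m y)).
  have := sqn_ge0 y.
  rewrite /h zE mulmxDr -bb -rr -Bii !sqnE.
  rewrite !(dotvDl, dotvDr, dotvNl, dotvNr, dotvZl, dotvZr) ee.
  rewrite (dotvC (B *m y) (B *m e)) (dotvC (B *m y) y) (dotvC y e).
  rewrite (dotvC y (B^T *m e)) (dotvC y (B *m e)) ry /t.
  lra.
have h0 z : 2 * (\sum_(i < n) a i 0 * z i) - qform (fun i j => K i j) z
    <= t * dotv u u.
  rewrite KE aE; set Z := \col_i z i.
  (* With [w = 2 Z - B Z], the left side is at most [t (2 u.w - |w|^2)], hence at most [t |u|^2]. *)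
  have := sqn_ge0 (u - (2 *: Z - B *m Z)); have := sqn_ge0 Z.
  rewrite !sqnE !(dotvDl, dotvDr, dotvNl, dotvNr, dotvZl, dotvZr).
  rewrite (dotvC Z u) (dotvC (B *m Z) u) (dotvC (B *m Z) Z) /t; lra.
have Ksym i j : K i j = K j i.
  have -> : K i j = (i == j)%:R - t * (2 * B i j + 2 * B j i - \sum_l B l i * B l j).
    by rewrite !mxE; congr (_ - _ * (_ - _)); apply: eq_bigr => l _; rewrite mxE.
  have -> : K j i = (j == i)%:R - t * (2 * B j i + 2 * B i j - \sum_l B l j * B l i).
    by rewrite !mxE; congr (_ - _ * (_ - _)); apply: eq_bigr => l _; rewrite mxE.
  rewrite eq_sym (addrC (2 * B i j)); congr (_ - _ * (_ - _)).
  by apply: eq_bigr => l _; rewrite mulrC.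
have := gaussian_exp_moment_le P sigma sigma_gt0 n xi (fun i j => K i j)
  (fun i => a i 0) h (t * dotv u u) iid Ksym hi h0.
set G := (fun w => _) => IH.
pose C := - t * (dotv u u / 2 + 2 * \tr B).
have -> : (\int[P]_w (expR ((2 * dotv (\col_i xi i w) (B *m (\col_i xi i w) + v)
      - 2 * sigma ^+ 2 * \tr B - sqn (B *m (\col_i xi i w) + v) / 2)
      / (46 * sigma ^+ 2)))%:E = \int[P]_w ((expR C)%:E * G w))%E.
  apply: eq_integral => w _; rewrite /G -EFinM -expRD; congr (expR _)%:E.
  rewrite KE aE; pose Z : 'cV[R]_n := \col_i (xi i w / sigma).
  rewrite -/Z.
  rewrite vE; have -> : \col_i xi i w = sigma *: Z.
    by apply/colP => i; rewrite !mxE mulrC divfK.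
  have -> : \sum_(i < n) (xi i w / sigma) ^+ 2 = dotv Z Z.
    by rewrite -sqnE; apply: eq_bigr => i _; rewrite mxE.
  rewrite sqnE -scalemxAr !(dotvDl, dotvDr, dotvZl, dotvZr).
  rewrite (dotvC u Z) (dotvC u (B *m Z)) /C /t; set ZZ := dotv Z Z.
  set x1 := dotv Z _; set x2 := dotv Z _; set x3 := dotv (B *m Z) _.
  set x4 := dotv _ _; set x5 := dotv _ _; set tr := \tr _.
  by field.
rewrite ge0_integralZl//=; last 2 first.
- have mz i : measurable_fun setT (fun w => xi i w / sigma) by exact: measurable_funM.
  apply/measurable_EFinP; apply: measurableT_comp => //; apply: measurable_funD.
    apply: measurable_funM => //; apply: measurable_funB.
      by apply: measurable_sum => i; apply: measurable_funX.
    apply: measurable_sum => i; apply: measurable_sum => j.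
    by apply: measurable_funM => //; apply: measurable_funM.
  by apply: measurable_sum => i; apply: measurable_funM.
- by move=> w _; rewrite lee_fin expR_ge0.
apply: (le_trans (lee_wpmul2l _ IH)); first by rewrite lee_fin expR_ge0.
rewrite -EFinM -expRD lee_fin -[leRHS]expR0 ler_expR.
(* Row and column squares both sum to the squared Frobenius norm, whose coefficient is
   [t (- 1 + 40 / 42)]: the constant 46 makes it negative. The trace and [|u|^2] then cancel against
   [C]. *)
have -> : \sum_i (h i - 1) = t * (4 * \tr B) - t / 21 * \sum_i \sum_l B l i ^+ 2.
  transitivity (\sum_i (t * 4 * B i i + (t * 4 / 21 * \sum_l B i l ^+ 2
      + - (t * 5 / 21) * \sum_l B l i ^+ 2))).
    by apply: eq_bigr => i _; rewrite /h; field.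
  rewrite !big_split/= -!big_distrr/= [X in _ + (_ * X + _)]exchange_big/=.
  by rewrite /mxtrace; field.
have : 0 <= \sum_i \sum_l B l i ^+ 2.
  by apply: sumr_ge0 => i _; apply: sumr_ge0 => l _; exact: sqr_ge0.
rewrite /C /t; set F := \sum_i _; lra.
Qed.

End chaos_exp_moment.

(** * Strong convexity along segments to a vertex *)

Section strong_convexity.
Context {R : realType} {n M : nat}.
Variables (m : 'I_M -> 'cV[R]_n) (g : 'I_M -> R).

Definition mix (th : 'I_M -> R) : 'cV[R]_n := \sum_(j < M) th j *: m j.

Definition mixobj (th : 'I_M -> R) : R :=
  sqn (mix th) / 2 + \sum_(j < M) th j * g j.

Definition vertex (k j : 'I_M) : R := (j == k)%:R.

Lemma sum_vertex (k : 'I_M) (F : 'I_M -> R) :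
  \sum_(j < M) vertex k j * F j = F k.
Proof.
rewrite (bigD1 k)//= /vertex eqxx mul1r big1 ?addr0// => j /negPf ->.
by rewrite mul0r.
Qed.

Lemma mix_vertex k : mix (vertex k) = m k.
Proof.
rewrite /mix (bigD1 k)//= /vertex eqxx scale1r big1 ?addr0// => j /negPf ->.
by rewrite scale0r.
Qed.

Lemma in_simplex_vertex k : in_simplex (vertex k).
Proof.
split=> [j|]; first by rewrite ler0n.
by rewrite -[RHS](sum_vertex k (fun=> 1)); apply: eq_bigr => j _; rewrite mulr1.
Qed.

Definition segment (th : 'I_M -> R) (k : 'I_M) (s : R) (j : 'I_M) : R :=
  (1 - s) * th j + s * vertex k j.

Lemma in_simplex_segment th k s : in_simplex th -> 0 <= s <= 1 ->
  in_simplex (segment th k s).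
Proof.
move=> [th0 th1] /andP[s0 s1]; have [v0 v1] := in_simplex_vertex k; split=> [j|].
  by rewrite addr_ge0// mulr_ge0// subr_ge0.
by rewrite big_split/= -!big_distrr/= th1 v1 !mulr1 subrK.
Qed.

(** The linear part is affine along the segment, and the convexity defect of half a squared norm is
    exact. *)
Lemma mixobj_segment th k s : mixobj (segment th k s) =
  (1 - s) * mixobj th + s * mixobj (vertex k)
  - s * (1 - s) / 2 * sqn (m k - mix th).
Proof.
have mixE : mix (segment th k s) = (1 - s) *: mix th + s *: m k.
  rewrite -mix_vertex /mix !scaler_sumr -big_split/=; apply: eq_bigr => j _.
  by rewrite !scalerA -scalerDl.
have sumE : \sum_(j < M) segment th k s j * g j =
    (1 - s) * (\sum_(j < M) th j * g j) + s * g k.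
  rewrite -(sum_vertex k g) !big_distrr/= -big_split/=; apply: eq_bigr => j _.
  by rewrite !mulrA -mulrDl.
rewrite /mixobj mixE sumE mix_vertex sum_vertex !sqnE; set u := mix th.
move: u => u; rewrite !(dotvDl, dotvDr, dotvNl, dotvNr, dotvZl, dotvZr).
by rewrite (dotvC u (m k)); field.
Qed.

Lemma mixobj_min_vertex th k :
  (forall s, 0 <= s <= 1 -> mixobj th <= mixobj (segment th k s)) ->
  mixobj th + sqn (m k - mix th) / 2 <= mixobj (vertex k).
Proof.
move=> thmin; rewrite leNgt; apply/negP => lt.
set V := mixobj th in thmin lt *; set W := mixobj (vertex k) in lt *.
have D0 := sqn_ge0 (m k - mix th).
have {}thmin s : 0 <= s <= 1 ->
    V <= (1 - s) * V + s * W - s * (1 - s) / 2 * sqn (m k - mix th).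
  by move=> s01; rewrite -mixobj_segment; exact: thmin.
move: (sqn _) D0 lt thmin => D D0 lt thmin.
have VW : V <= W by have := thmin 1; rewrite lexx ler01 => /(_ isT); lra.
have Dp : 0 < D by lra.
(* An explicit step replaces the limit [s -> 0]: for this [s] the change in the objective is
   [- s ^+ 2 * D / 2 < 0]. *)
pose s := (V + D / 2 - W) / D.
have sD : s * D = V + D / 2 - W by rewrite /s divfK// lt0r_neq0.
have s0 : 0 < s by rewrite divr_gt0// subr_gt0.
have s1 : s <= 1 by rewrite ler_pdivrMr// mul1r; lra.
have := thmin s; rewrite (ltW s0) s1 => /(_ isT).
rewrite -subr_ge0.
have -> : (1 - s) * V + s * W - s * (1 - s) / 2 * D - V =
    s * (W - V - D / 2 + (s * D) / 2) by field.
by rewrite pmulr_rge0// sD; lra.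
Qed.

End strong_convexity.

(** * The deterministic oracle inequality *)

Section oracle_inequality.
Context {R : realType} {n M : nat}.
Variables (A : 'I_M -> 'M[R]_n) (b : 'I_M -> 'cV[R]_n) (sigma : R) (pi : 'I_M -> R).
Hypotheses (sigma_gt0 : 0 < sigma) (pi_simplex : in_simplex pi).

(** At [pi j = 0] this is a default real value instead of [+oo]; the uses below give such indices
    weight 0 or exclude them. *)
Let lpi (j : 'I_M) : R := ln (pi j)^-1.

Lemma dotv_mix (m : 'I_M -> 'cV[R]_n) (u : 'cV[R]_n) th :
  dotv u (mix m th) = \sum_(j < M) th j * dotv u (m j).
Proof.
rewrite /mix; elim/big_rec2: _ => [|j s v _ IH].
  by rewrite -(scale0r u) dotvZr mul0r.
by rewrite dotvDr dotvZr IH.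
Qed.

Lemma muthE th y : muth A b th y = mix (fun j => muj A b j y) th.
Proof.
rewrite /muth /Ath /bth /mix mulmx_suml -big_split/=; apply: eq_bigr => j _.
by rewrite /muj scalerDr scalemxAl.
Qed.

(** Variance decomposition around the barycentre. Half of it, added to [Cp], leaves half the squared
    norm of the mixture. *)
Lemma penE th y : in_simplex th ->
  pen A b th y = \sum_(j < M) th j * sqn (muj A b j y) - sqn (muth A b th y).
Proof.
move=> [_ th1]; rewrite muthE; set m := fun j => muj A b j y; set u := mix m th.
have -> : pen A b th y = \sum_(j < M) (th j * sqn (m j) +
    (th j * sqn u + - 2 * (th j * dotv u (m j)))).
  apply: eq_bigr => j _; rewrite muthE -/m -/u !sqnE.
  move: u => u; rewrite -/(m j); move: (m j) => mj.
  by rewrite !(dotvDl, dotvDr, dotvNl, dotvNr) (dotvC mj u); ring.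
rewrite !big_split/= -big_distrl/= -big_distrr/= th1 -dotv_mix -/u sqnE.
by rewrite /m; ring.
Qed.

Let obj_lin y (j : 'I_M) : R := sqn (muj A b j y) / 2 - 2 * dotv y (muj A b j y)
  + 2 * sigma ^+ 2 * \tr (A j) + 46 * sigma ^+ 2 * lpi j.

Lemma Hpen_mixobj th y : in_simplex th ->
  Hpen A b sigma th y + 46 * sigma ^+ 2 * (\sum_(j < M) th j * lpi j) =
  mixobj (fun j => muj A b j y) (obj_lin y) th.
Proof.
move=> sth; rewrite /Hpen penE// /Cp /mixobj -muthE.
have -> : \sum_(j < M) th j * obj_lin y j = (\sum_(j < M) th j * sqn (muj A b j y)) / 2
    - 2 * dotv y (muth A b th y) + 2 * sigma ^+ 2 * \tr (Ath A th)
    + 46 * sigma ^+ 2 * (\sum_(j < M) th j * lpi j).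
  rewrite muthE dotv_mix /Ath raddf_sum/= -mulNr !big_distrr/= big_distrl/=.
  rewrite -!big_split/=; apply: eq_bigr => j _.
  by rewrite mxtraceZ /obj_lin; ring.
by field.
Qed.

Lemma Vpen_fin th y : (forall j, pi j = 0 -> th j = 0) ->
  Vpen A b sigma pi th y =
  (Hpen A b sigma th y + 46 * sigma ^+ 2 * (\sum_(j < M) th j * lpi j))%:E.
Proof.
move=> supp; rewrite /Vpen [RHS]EFinD [X in _ = (_ + X)%E]EFinM -sumEFin; congr (_ + _ * _)%E.
apply: eq_bigr => j _; rewrite /logInv; case: eqP => [pj|_]; last by rewrite EFinM.
by rewrite supp// mul0e mul0r.
Qed.

(** As [pi j <= 1], every logarithm is nonnegative, so no term can offset an infinite one. *)
Lemma Vpen_support th y : in_simplex th -> (Vpen A b sigma pi th y < +oo)%E ->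
  forall j, pi j = 0 -> th j = 0.
Proof.
move=> [th0 _] Vlt j pj; apply/eqP; rewrite -[_ == _]negbK; apply/negP => thj.
have [pi0 pi1] := pi_simplex.
have pile1 i : pi i <= 1.
  by rewrite -pi1 (bigD1 i)//= lerDl sumr_ge0.
have logInv_ge0 i : (0 <= logInv (pi i))%E.
  rewrite /logInv; case: eqP => [_|/eqP pin0]; first exact: leey.
  by rewrite lee_fin ln_ge0// invf_ge1 ?pile1// lt0r pin0 pi0.
move: Vlt; rewrite /Vpen (bigD1 j)//= {1}/logInv pj eqxx.
rewrite gt0_muley ?lte_fin ?lt0r ?thj ?th0// addye; last first.
  rewrite gt_eqF// (@lt_le_trans _ _ 0%E)//.
  by apply: sume_ge0 => i _; rewrite mule_ge0// lee_fin.
by rewrite gt0_muley ?lte_fin ?mulr_gt0 ?exprn_gt0// addey.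
Qed.

(** The [th]-average of [lpi j] in the deviation bound cancels the prior term of the objective at
    [th]. The deviation bound and the objective at the vertex each leave one
    [46 * sigma ^+ 2 * lpi k], whence 92. *)
Lemma oracle_inequality th (f z : 'cV[R]_n) (k : 'I_M) (x : R) :
  in_simplex th ->
  (forall th', in_simplex th' ->
    (Vpen A b sigma pi th (f + z) <= Vpen A b sigma pi th' (f + z))%E) ->
  pi k != 0 ->
  (forall j, pi j != 0 ->
    2 * dotv z (muj A b j (f + z) - muj A b k (f + z))
    - 2 * sigma ^+ 2 * \tr (A j - A k)
    - sqn (muj A b j (f + z) - muj A b k (f + z)) / 2
    <= 46 * sigma ^+ 2 * (lpi j + lpi k + x)) ->
  sqn (muth A b th (f + z) - f) <=
  sqn (muj A b k (f + z) - f) + 92 * sigma ^+ 2 * lpi k + 46 * sigma ^+ 2 * x.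
Proof.
set y := f + z => sth thmin pk dev.
have [th0 th1] := sth.
have vsupp j : pi j = 0 -> vertex (R := R) k j = 0.
  by rewrite /vertex; case: eqP => // -> pk0; rewrite pk0 eqxx in pk.
(* The objective is finite at the vertex [k], hence at the minimiser. *)
have supp : forall j, pi j = 0 -> th j = 0.
  apply: (Vpen_support _ y sth); apply: le_lt_trans (thmin _ (in_simplex_vertex k)) _.
  by rewrite Vpen_fin// ltry.
pose m j := muj A b j y.
have conv : mixobj m (obj_lin y) th + sqn (m k - mix m th) / 2
    <= mixobj m (obj_lin y) (vertex k).
  apply: mixobj_min_vertex => s s01.
  have ssth := in_simplex_segment th k s sth s01.
  rewrite -!Hpen_mixobj// -lee_fin -!Vpen_fin//; first exact: thmin.
  by move=> j pj; rewrite /segment supp// vsupp// !mulr0 addr0.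
have devsum : \sum_(j < M) th j * (2 * dotv z (m j - m k)
    - 2 * sigma ^+ 2 * \tr (A j - A k) - sqn (m j - m k) / 2)
    <= \sum_(j < M) th j * (46 * sigma ^+ 2 * (lpi j + lpi k + x)).
  apply: ler_sum => j _; have [pj|pj] := eqVneq (pi j) 0.
    by rewrite supp// !mul0r.
  by rewrite ler_wpM2l// dev.
have devl : \sum_(j < M) th j * (2 * dotv z (m j - m k)
    - 2 * sigma ^+ 2 * \tr (A j - A k) - sqn (m j - m k) / 2) =
    2 * dotv z (mix m th) - 2 * dotv z (m k)
    - 2 * sigma ^+ 2 * (\sum_(j < M) th j * \tr (A j)) + 2 * sigma ^+ 2 * \tr (A k)
    - (\sum_(j < M) th j * sqn (m j)) / 2 + dotv (m k) (mix m th) - sqn (m k) / 2.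
  rewrite !dotv_mix.
  transitivity (\sum_(j < M) (2 * (th j * dotv z (m j))
      + (- 2 * sigma ^+ 2 * (th j * \tr (A j)) + (- 2^-1 * (th j * sqn (m j))
      + (th j * dotv (m k) (m j) + th j * (- 2 * dotv z (m k)
         + 2 * sigma ^+ 2 * \tr (A k) - sqn (m k) / 2)))))).
    apply: eq_bigr => j _; rewrite raddfB/= !sqnE.
    move: (m j) (m k) => u v; rewrite !(dotvDl, dotvDr, dotvNl, dotvNr) (dotvC u v).
    by field.
  rewrite !big_split/= -!big_distrr/= -big_distrl/= th1; ring.
have devr : \sum_(j < M) th j * (46 * sigma ^+ 2 * (lpi j + lpi k + x)) =
    46 * sigma ^+ 2 * (\sum_(j < M) th j * lpi j) + 46 * sigma ^+ 2 * (lpi k + x).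
  transitivity (\sum_(j < M) (46 * sigma ^+ 2 * (th j * lpi j)
      + th j * (46 * sigma ^+ 2 * (lpi k + x)))).
    by apply: eq_bigr => j _; ring.
  by rewrite big_split/= -big_distrr/= -big_distrl/= th1 mul1r.
move: devsum conv; rewrite devl devr {devl devr} muthE -/m /mixobj.
rewrite sum_vertex mix_vertex.
have -> : \sum_(j < M) th j * obj_lin y j = (\sum_(j < M) th j * sqn (m j)) / 2
    - 2 * dotv y (mix m th) + 2 * sigma ^+ 2 * (\sum_(j < M) th j * \tr (A j))
    + 46 * sigma ^+ 2 * (\sum_(j < M) th j * lpi j).
  rewrite dotv_mix -mulNr !big_distrr/= big_distrl/=.
  by rewrite -!big_split/=; apply: eq_bigr => j _; rewrite /obj_lin -/(m j); ring.
rewrite /obj_lin -/(m k) -/y !sqnE.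
move: (mix m th) (m k) => u v.
rewrite !(dotvDl, dotvDr, dotvNl, dotvNr) (dotvC u v) (dotvC u f) (dotvC v f).
lra.
Qed.

End oracle_inequality.

(** * Markov's inequality and the high-probability bound *)

Lemma probability_le_markov (d : measure_display) (T : measurableType d)
    (R : realType) (P : probability T R) (Y : T -> R) (c : R) :
  measurable_fun setT Y -> (forall w, 0 <= Y w) -> 0 < c ->
  (\int[P]_w (Y w)%:E <= 1)%E ->
  measurable [set w | Y w <= c] /\ (P [set w | (Y w <= c)%R] >= (1 - c^-1)%:E)%E.
Proof.
move=> mY Y0 c0 intY.
have mE : measurable [set w | Y w <= c].
  rewrite -[X in measurable X]setTI.
  have -> : [set w | Y w <= c] = Y @^-1` `]-oo, c]%classic.
    by apply/seteqP; split=> w /=; rewrite in_itv.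
  exact: mY.
have mEC := measurableC mE; split=> //.
have : (c%:E * P (~` [set w | (Y w <= c)%R]) <= 1)%E.
  apply: le_trans intY; rewrite -integral_cst//.
  apply: (@le_trans _ _ (\int[P]_(w in ~` [set w | (Y w <= c)%R]) (Y w)%:E)%E).
    apply: ge0_le_integral => //.
    - by move=> w _; rewrite lee_fin ltW.
    - exact/measurable_funTS/measurable_EFinP.
    - by move=> w /= /negP; rewrite -ltNge lee_fin => /ltW.
  apply: ge0_subset_integral => //; first exact/measurable_EFinP.
  by move=> w _; rewrite lee_fin.
rewrite probability_setC// -(fineK (fin_num_measure P _ mE)) -EFinB -EFinM !lee_fin.
by rewrite -ler_pdivlMl// mulr1; lra.
Qed.

Theorem theorem5p1 (R : realType) (d : measure_display) (Omega : measurableType d)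
  (P : probability Omega R) (n M : nat) (sigma : R)
  (f : 'cV[R]_n) (xi : 'I_n -> Omega -> R)
  (A : 'I_M -> 'M[R]_n) (b : 'I_M -> 'cV[R]_n) (pi : 'I_M -> R)
  (thhat : Omega -> 'I_M -> R) (x : R) :
  (2 <= M)%N ->
  0 < sigma ->
  (* xi_1, ..., xi_n are i.i.d. N(0, sigma^2), i.e. xi ~ N(0, sigma^2 I_n) *)
  (forall i, measurable_fun setT (xi i)) ->
  (forall i (B : set R), measurable B -> P (xi i @^-1` B) = normal_prob 0 sigma B) ->
  (forall B : 'I_n -> set R, (forall i, measurable (B i)) ->
     fine (P (\bigcap_(i in [set: 'I_n]) (xi i @^-1` B i)))
     = \prod_(i < n) fine (P (xi i @^-1` B i))) ->
  (forall j, opnorm_le1 (A j)) ->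
  in_simplex pi ->
  (* y = f + xi ; thhat(omega) is a minimizer of V_pen over Lambda^M *)
  (forall w, in_simplex (thhat w) /\
     forall th, in_simplex th ->
       (Vpen A b sigma pi (thhat w) (f + \col_i xi i w)
          <= Vpen A b sigma pi th (f + \col_i xi i w))%E) ->
  0 < x ->
  exists E : set Omega, measurable E /\
    (P E >= (1 - 2 * expR (- x))%:E)%E /\
    E `<=` [set w | ((sqn (muth A b (thhat w) (f + \col_i xi i w) - f))%:E
       <= \big[Order.min/+oo%E]_(j < M)
            ((sqn (muj A b j (f + \col_i xi i w) - f))%:E
              + (92 * sigma ^+ 2)%:E * logInv (pi j))
          + (46 * sigma ^+ 2 * x)%:E)%E].
Proof.
move=> _ sigma_gt0 mxi lxi indep Aop pi_simplex thhatP x_gt0.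
have iid : iid_normal P sigma n xi by split.
have [pi_ge0 pi_sum1] := pi_simplex.
have s2 : 0 < 46 * sigma ^+ 2 by rewrite mulr_gt0// exprn_gt0.
pose z w : 'cV[R]_n := \col_i xi i w.
pose D j k w := (2 * dotv (z w) (muj A b j (f + z w) - muj A b k (f + z w))
  - 2 * sigma ^+ 2 * \tr (A j - A k)
  - sqn (muj A b j (f + z w) - muj A b k (f + z w)) / 2) / (46 * sigma ^+ 2).
have mujB j k w : muj A b j (f + z w) - muj A b k (f + z w) =
    (A j - A k) *m z w + ((A j - A k) *m f + (b j - b k)).
  by rewrite /muj opprD addrACA -mulmxBl mulmxDr (addrC (_ *m f)) -addrA.
have mD j k : measurable_fun setT (D j k).
  have mcoord i : measurable_fun setT
      (fun w => (muj A b j (f + z w) - muj A b k (f + z w)) i 0).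
    have -> : (fun w => (muj A b j (f + z w) - muj A b k (f + z w)) i 0) =
        (fun w => \sum_l (A j - A k) i l * xi l w
           + ((A j - A k) *m f + (b j - b k)) i 0).
      apply/funext => w; rewrite mujB [LHS]mxE; congr (_ + _).
      by rewrite mxE; apply: eq_bigr => l _; rewrite [X in _ * X = _]mxE.
    apply: measurable_funD => //; apply: measurable_sum => l.
    exact: measurable_funM.
  apply: measurable_funM => //; apply: measurable_funB; last first.
    apply: measurable_funM => //; apply: measurable_sum => i.
    exact: measurable_funX.
  apply: measurable_funB => //; apply: measurable_funM => //.
  apply: measurable_sum => i; apply: measurable_funM => //.
  have -> : (fun w => z w i 0) = xi i by apply/funext => w; rewrite mxE.
  exact: mxi.
have intD j k : (\int[P]_w (expR (D j k w))%:E <= 1)%E.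
  under eq_integral do rewrite /D mujB.
  apply: penalized_chaos_exp_moment_le1 => // y.
  (* By the parallelogram identity, a difference of two contractions has operator norm at most 2. *)
  rewrite mulmxBl; have := Aop j y; have := Aop k y.
  have := sqn_ge0 (A j *m y + A k *m y).
  rewrite !sqnE !(dotvDl, dotvDr, dotvNl, dotvNr) (dotvC (A k *m y) (A j *m y)); lra.
(* The weights sum to 1, so [Y] keeps mean at most 1; the price of uniformity over pairs is the
   logarithm of the weight. *)
pose Y w := \sum_(j < M) \sum_(k < M) pi j * pi k * expR (D j k w).
have Y_term_ge0 j k w : 0 <= pi j * pi k * expR (D j k w).
  by rewrite !mulr_ge0 ?expR_ge0.
have mterm j k : measurable_fun setT (fun w => pi j * pi k * expR (D j k w)).
  by apply: measurable_funM => //; exact: measurableT_comp.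
have mY : measurable_fun setT Y.
  by apply: measurable_sum => j; apply: measurable_sum.
have Y_ge0 w : 0 <= Y w by apply: sumr_ge0 => j _; apply: sumr_ge0.
have intY : (\int[P]_w (Y w)%:E <= 1)%E.
  have -> : (\int[P]_w (Y w)%:E = \sum_(j < M) \sum_(k < M)
      \int[P]_w (pi j * pi k * expR (D j k w))%:E)%E.
    under eq_integral do rewrite /Y -sumEFin.
    rewrite ge0_integral_sum//; last 2 first.
    - by move=> j; apply/measurable_EFinP; apply: measurable_sum.
    - by move=> j w _; rewrite lee_fin sumr_ge0.
    apply: eq_bigr => j _; under eq_integral do rewrite -sumEFin.
    rewrite ge0_integral_sum//.
    - by move=> k; exact/measurable_EFinP.
    - by move=> k w _; rewrite lee_fin.
  apply: (@le_trans _ _ (\sum_(j < M) \sum_(k < M) (pi j * pi k)%:E)%E).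
    apply: lee_sum => j _; apply: lee_sum => k _.
    under eq_integral do rewrite EFinM.
    rewrite ge0_integralZl//=; last 2 first.
    - by apply/measurable_EFinP; exact: measurableT_comp.
    - by rewrite lee_fin mulr_ge0.
    by rewrite -[leRHS]mule1 lee_wpmul2l// lee_fin mulr_ge0.
  under eq_bigr do rewrite sumEFin.
  rewrite sumEFin lee_fin.
  under eq_bigr do rewrite -big_distrr/= pi_sum1 mulr1.
  by rewrite pi_sum1.
have [mE PE] := probability_le_markov _ _ _ P Y (expR x) mY Y_ge0 (expR_gt0 x) intY.
(* The event does not involve [thhat], so it is measurable whatever minimiser is selected. Its
   probability is at least [1 - expR (- x)], which is stronger than required. *)
exists [set w | Y w <= expR x]; split=> //; split.
  apply: le_trans PE; rewrite lee_fin -expRN lerB// ler_peMl ?expR_ge0//.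
  by rewrite ler1n.
move=> w /= Yw; have [sth thmin] := thhatP w.
rewrite -leeBlDr//; apply: le_bigmin => [|k _]; first exact: leey.
rewrite leeBlDr// /logInv; case: eqP => [_|/eqP pk].
  rewrite gt0_muley ?lte_fin ?mulr_gt0 ?exprn_gt0//.
  by rewrite addey// addye// leey.
rewrite -EFinM -!EFinD lee_fin.
apply: (oracle_inequality A b sigma pi) => // j pj.
rewrite -ler_pdivrMl// mulrC -/(D j k w).
have pj0 : 0 < pi j by rewrite lt0r pj pi_ge0.
have pk0 : 0 < pi k by rewrite lt0r pk pi_ge0.
(* A single nonnegative term is at most [Y]; taking logarithms gives [D j k w] at most [x] plus both
   prior logarithms. *)
have term : pi j * pi k * expR (D j k w) <= expR x.
  apply: le_trans Yw; rewrite /Y (bigD1 j)//= (bigD1 k)//= -addrA lerDl.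
  by rewrite addr_ge0// sumr_ge0// => i _; rewrite sumr_ge0.
rewrite -ler_expR !expRD !lnK ?posrE ?invr_gt0//.
by rewrite -invfM ler_pdivlMl ?mulr_gt0.
Qed.
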